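(* Let $G$ be a hereditary Lindelöf locally compact group and $X$ a totally Baire $G$-space. Let $x\in X$ be a point such that the closure $\overline{G\cdot x}$ of the orbit $G\cdot x$ in $X$ contains a non-empty subset which is open in $\overline{G\cdot x}$ and Hausdorff. Then the following are equivalent: 1. The orbit $G\cdot x$ is a homogeneous space. 2. $G\cdot x$ is locally compact in the relative topology of $X$. 3. $G\cdot x$ is locally closed in $X$. 4. $G\cdot x$ is a $G_\delta$-subset of its closure. 5. $G\cdot x$ is a Baire space in the relative topology of $X$.
   Context: All topological groups and topological spaces are assumed to be $T_0$ (hence topological groups are Hausdorff). A $G$-space is a ($T_0$) topological space $X$ with a continuous map $G\times X\to X$, $(g,x)\mapsto g\cdot x$, such that $g\cdot(h\cdot x)=(gh)\cdot x$ and $e\cdot x=x$. A space is quasi-compact if every open cover has a finite subcover; locally quasi-compact if every neighborhood of every point $x$ contains a quasi-compact neighborhood of $x$; locally compact means locally quasi-compact and Hausdorff. A space is Lindelöf if every open cover has a countable subcover, and hereditary Lindelöf if every open subset is Lindelöf in the relative topology. A space is Baire if the intersection of any sequence of dense open subsets is dense; it is totally Baire if every closed subspace is Baire. A subset is locally closed if it is the intersection of a closed and an open subset (equivalently, relatively open in its closure). A $G_\delta$-subset is a countable intersection of open subsets. For $x\in X$ put $G_x=\{g\in G: g\cdot x=x\}$ (a closed subgroup). The orbit $G\cdot x$ (with relative topology) is a homogeneous space if the map $G/G_x\to G\cdot x$, $gG_x\mapsto g\cdot x$, is a homeomorphism. *)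

(* Defs.v *)
From HB Require Import structures.
From mathcomp Require Import all_boot all_classical.
From mathcomp Require Import topology borel_hierarchy.

Set Implicit Arguments.
Unset Strict Implicit.
Unset Printing Implicit Defensive.

Local Open Scope classical_set_scope.
Local Open Scope quotient_scope.

(* A property of a subset [A] "in the relative topology" is the property of   *)
(* the space [set_type A] (the coercion of [A] to a type), whose topology is  *)
(* induced by [set_val].  The library's [subspace A] is not suitable here: it *)
(* keeps the points outside of [A], as isolated points.                       *)

Section TopologicalNotions.
Variable T : topologicalType.

(* Quasi-compactness is [cover_compact].  The library's [locally_compact]     *)
(* differs: it asks for one closed compact neighborhood of each point.        *)
Definition locally_quasicompact :=
  forall (x : T) (U : set T), nbhs x U ->
    exists K : set T, [/\ nbhs x K, cover_compact K & K `<=` U].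

Definition locally_compact_space :=
  locally_quasicompact /\ hausdorff_space T.

Definition lindelof_space :=
  forall F : set (set T), (forall U, F U -> open U) ->
    \bigcup_(U in F) U = setT ->
    exists F' : set (set T),
      [/\ countable F', F' `<=` F & \bigcup_(U in F') U = setT].

Definition baire_space :=
  forall U : nat -> set T, (forall n, open (U n)) -> (forall n, dense (U n)) ->
    dense (\bigcap_n U n).

Definition locally_closed (A : set T) :=
  exists C U : set T, [/\ closed C, open U & A = C `&` U].

End TopologicalNotions.

Definition hereditary_lindelof_space (T : topologicalType) :=
  forall U : set T, open U -> lindelof_space U.

Definition totally_baire_space (T : topologicalType) :=
  forall C : set T, closed C -> baire_space C.

Definition homeomorphism (S T : topologicalType) (f : S -> T) :=
  exists g : T -> S, [/\ cancel f g, cancel g f, continuous f & continuous g].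

(* No separation axiom is built into the next two structures.                 *)
HB.mixin Record isTopologicalGroup G of Topological G & Group G := {
  topgroup_mul_continuous : continuous (fun p : G * G => (p.1 * p.2)%g) ;
  topgroup_inv_continuous : continuous (fun g : G => (g^-1)%g)
}.

#[short(type="topologicalGroupType")]
HB.structure Definition TopologicalGroup :=
  {G of Topological G & Group G & isTopologicalGroup G}.

HB.mixin Record isGSpace (G : topologicalGroupType) X of Topological X := {
  gact : G -> X -> X ;
  gact_continuous : continuous (fun p : G * X => gact p.1 p.2) ;
  gactM : forall (g h : G) (x : X), gact g (gact h x) = gact (g * h)%g x ;
  gact1 : forall x : X, gact 1%g x = x
}.

#[short(type="gspaceType")]
HB.structure Definition GSpace (G : topologicalGroupType) :=
  {X of Topological X & isGSpace G X}.

Section Orbits.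
Variables (G : topologicalGroupType) (X : gspaceType G) (x : X).

Definition gorbit : set X := range (fun g : G => gact g x).

Definition stabilizer : set G := [set g | gact g x = x].

Lemma stabilizer1 : stabilizer 1%g.
Proof. exact: gact1. Qed.

Lemma stabilizerV (g : G) : stabilizer g -> stabilizer (g^-1)%g.
Proof. by move=> gx; rewrite /stabilizer/= -[in LHS]gx gactM mulVg gact1. Qed.

Lemma stabilizerM (g h : G) :
  stabilizer g -> stabilizer h -> stabilizer (g * h)%g.
Proof. by rewrite /stabilizer/= => gx hx; rewrite -gactM hx gx. Qed.

(* [g] and [h] are related iff the left cosets [g G_x] and [h G_x] are equal. *)
Definition same_coset (g h : G) : bool := `[< stabilizer (g^-1 * h)%g >].

Lemma same_coset_refl : reflexive same_coset.
Proof. by move=> g; apply/asboolP; rewrite mulVg; exact: stabilizer1. Qed.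

Lemma same_coset_sym : symmetric same_coset.
Proof.
move=> g h; apply/asboolP/asboolP => /stabilizerV;
  by rewrite invgM invgK.
Qed.

Lemma same_coset_trans : transitive same_coset.
Proof.
move=> h g k /asboolP gh /asboolP hk; apply/asboolP.
by have := stabilizerM gh hk; rewrite -mulgA mulVKg.
Qed.

Canonical same_coset_equiv :=
  EquivRel same_coset same_coset_refl same_coset_sym same_coset_trans.

Definition coset_space := quotient_topology {eq_quot same_coset_equiv}.

Definition coset_to_gorbit (q : coset_space) : gorbit :=
  exist _ (gact (repr q) x) (mem_set (imageT (fun g : G => gact g x) (repr q))).

Lemma coset_to_gorbit_pi (g : G) :
  set_val (coset_to_gorbit (\pi_coset_space g)) = gact g x.
Proof.
rewrite set_valE /=.
have /eqmodP/asboolP : repr (\pi_{eq_quot same_coset_equiv} g)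
    = g %[mod {eq_quot same_coset_equiv}] by rewrite reprK.
rewrite /stabilizer /= => e.
by rewrite -[x in LHS]e gactM mulVKg.
Qed.

Definition homogeneous_orbit := homeomorphism coset_to_gorbit.

End Orbits.

(* Main.v *)
(* The orbit is homogeneous iff [g |-> g x] is open onto it, in which case it *)
(* inherits local compactness and the Hausdorff property from [G] modulo the  *)
(* closed stabilizer.  Translating the Hausdorff open set, [x] has an open    *)
(* neighborhood [W] whose trace on the closure of the orbit is Hausdorff.     *)
(* Compact subsets of [W] are closed there: hence a locally compact orbit is  *)
(* open in its closure, and, as countably many translates of a compact [K]    *)
(* cover [G], a Baire orbit has some [g K x] with non-empty interior, which   *)
(* makes the orbit map open.  A dense G_delta of the (Baire) closure is Baire.*)
From HB Require Import structures.
Require Import Defs.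
From mathcomp Require Import all_boot all_classical.
From mathcomp Require Import topology borel_hierarchy.

Set Implicit Arguments.
Unset Strict Implicit.
Unset Printing Implicit Defensive.

Local Open Scope classical_set_scope.

(** The five conditions are linked in a cycle. The pivot is [homogeneous_orbitP]: homogeneity says
    exactly that g |-> g x is open onto the orbit. Openness carries compact neighborhoods from G to
    the orbit and, as the stabilizer is closed, separates its points
    ([homogeneous_orbit_locally_compact]). Since X is only T0, compact sets need not be closed. The
    Hausdorff hypothesis repairs this near x: it yields an open W around x such that compact subsets
    of the trace of W on the orbit closure are closed in that trace ([hausdorff_nbhs_gorbit],
    [compact_relatively_closed]). A compact neighborhood of x in the orbit then contains a
    neighborhood of x in the closure, and translation makes the orbit locally closed
    ([locally_compact_gorbit_closed]), hence a G_delta of its closure. The closure is Baire, and a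
    dense G_delta inherits this ([dense_Gdelta_baire]). The way back is the category argument of the
    open mapping theorem ([baire_gorbit_open]). *)

(** Phrased with filters of [T] instead of the subspace type, so that it combines with compactness
    in [T] and can be pulled back along maps of the ambient space. *)
Definition relatively_hausdorff (T : topologicalType) (A : set T) :=
  forall p q, A p -> A q -> cluster (within A (nbhs p)) q -> p = q.

(** * Relative topology: compactness, Baire category and countable covers *)

Section RelativeTopology.
Variable T : topologicalType.
Implicit Types (A K : set T).

Lemma set_val_continuous A : continuous (set_val : A -> T).
Proof. exact: initial_continuous. Qed.

Lemma set_valP A (a : A) : A (set_val a).
Proof. by rewrite set_valE; exact: set_mem (valP a). Qed.

Lemma set_val_surj A (t : T) : A t -> exists a : A, set_val a = t.
Proof. by move=> At; exists (exist _ t (mem_set At)); rewrite set_valE. Qed.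

Lemma set_val_inj A : injective (set_val : A -> T).
Proof. by move=> a b; rewrite set_valE => /val_inj. Qed.

Lemma nbhs_set_typeP A (a : A) (V : set A) :
  nbhs a V -> exists W, [/\ open W, W (set_val a) & set_val @^-1` W `<=` V].
Proof. by rewrite nbhsE => -[_ [[W oW <-] Wa] WV]; exists W. Qed.

Lemma hausdorff_set_type A : hausdorff_space A -> relatively_hausdorff A.
Proof.
move=> hA _ _ /set_val_surj[p <-] /set_val_surj[q <-] pq; congr (set_val _).
apply: hA => V W /nbhs_set_typeP[V' [oV' V'p sV]].
move=> /nbhs_set_typeP[W' [oW' W'q sW]].
have [||_ [[/set_val_surj[z <-] V'z] W'z]] := pq (A `&` V') W'.
- by apply: filterS (open_nbhs_nbhs (conj oV' V'p)) => y.
- exact: open_nbhs_nbhs.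
by exists z; split; [exact: sV|exact: sW].
Qed.

(* The library's [compact_cover] is restricted to pointed spaces. *)
Lemma compact_coverP A : compact A <-> cover_compact A.
Proof.
have [[t _]|T0] := pselect (exists t : T, True).
  pose P : ptopologicalType :=
    HB.pack (Topological.sort T) (isPointed.Build T t).
  by rewrite -[cover_compact A]/(@cover_compact P A) -compact_cover.
have -> : A = set0 by apply/seteqP; split=> t //; case: T0; exists t.
split=> [_ I D f _ _|_]; last exact: compact0.
by exists finmap.fset0 => // i; rewrite finmap.in_fset0.
Qed.

(** If p lies in the closure of K, the trace on K of the neighborhoods of p is a proper filter, so
    it clusters at some q in K. Then q is also a cluster point of the trace on A, and p = q. *)
Lemma compact_relatively_closed A K :
  relatively_hausdorff A -> compact K -> K `<=` A -> A `&` closure K `<=` K.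
Proof.
move=> hA cK KA p [Ap clKp].
have pK : ProperFilter (within K (nbhs p)) by exact: within_nbhs_proper.
have [|q [Kq pq]] := cK _ pK; first exact: withinT.
rewrite (hA p q) //; first exact: KA.
move=> V W AV Wq; apply: pq => //.
by apply: (@filterS _ (nbhs p) _ _ _ _ AV) => z Vz /KA; exact: Vz.
Qed.

(** Write A as the intersection of the [F n], and a dense open set of A as the trace of some [W n].
    Then [W n] meets [F n] in a dense open set of the closure, because A is dense there; the
    intersection of all these lies in A. *)
Lemma dense_Gdelta_baire A : baire_space (closure A) ->
  Gdelta [set y : closure A | A (set_val y)] -> baire_space A.
Proof.
move=> bC [F oF AF] U oU dU.
have /choice[W HW] n : exists W, open W /\ U n = set_val @^-1` W.
  by have [W oW <-] := oU n; exists W.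
have AP (O : set T) (c : closure A) : open O -> O (set_val c) ->
    exists a : A, O (set_val a).
  move=> oO Oc.
  have [_ [/set_val_surj[a <-] Oa]] :=
    set_valP c O (open_nbhs_nbhs (conj oO Oc)).
  by exists a.
have AC (a : A) : exists c : closure A, set_val c = set_val a.
  by apply: set_val_surj; apply: subset_closure; exact: set_valP.
pose V n : set (closure A) := set_val @^-1` (W n) `&` F n.
have oV n : open (V n).
  by apply: openI; [exists (W n) => //; exact: (HW n).1|exact: oF].
have dV n : dense (V n).
  move=> _ /[swap] -[O oO <-] [c Oc].
  have [a Oa] := AP O c oO Oc.
  have [||b [Ob Ub]] := dU n (set_val @^-1` O); [by exists a|by exists O|].
  have [d db] := AC b; exists d; split; first by rewrite /= db.
  split; first by rewrite /= db; rewrite (HW n).2 in Ub.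
  have : [set y : closure A | A (set_val y)] d
    by rewrite /= db; exact: set_valP.
  by rewrite AF => /(_ n); exact.
move=> _ /[swap] -[O oO <-] [a Oa].
have [c ca] := AC a.
have [||d [Od Vd]] := bC V oV dV (set_val @^-1` O).
- by exists c; rewrite /= ca.
- by exists O.
have /set_val_surj[b bd] : A (set_val d).
  suff : [set y : closure A | A (set_val y)] d by [].
  by rewrite AF => n _; have [] := Vd n I.
exists b; split; first by rewrite /= bd.
by move=> n _; rewrite (HW n).2 /= bd; have [] := Vd n I.
Qed.

(** Otherwise the complements of the closures are dense open sets, and a point common to all of them
    escapes the cover. *)
Lemma baire_countable_cover (F : set (set T)) : baire_space T ->
  [set: T] !=set0 -> countable F -> \bigcup_(A in F) A = setT ->
  exists2 A, F A & (closure A)° !=set0.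
Proof.
move=> bT T0 /countable_injP[f finj] FT; apply: contrapT => Fnd.
(* As [f] is injective on [F], [B n] is the member with code [n], or empty when there is none. *)
pose B n := \bigcup_(A in [set A | F A /\ f A = n]) A.
have dB n : dense (~` closure (B n)).
  move=> O [t Ot] oO; apply: contrapT => OB.
  have OcB : O `<=` closure (B n).
    by move=> s Os; apply: contrapT => Bs; apply: OB; exists s.
  have [_ [[A [FA fA] _] _]] := OcB t Ot O (open_nbhs_nbhs (conj oO Ot)).
  apply: Fnd; exists A => //; exists t.
  have BA : B n `<=` A.
    move=> s [A' [FA' fA']]; suff -> : A' = A by [].
    by apply: finj; rewrite ?inE // fA fA'.
  apply: filterS (open_nbhs_nbhs (conj oO Ot)).
  exact: subset_trans OcB (closureS BA).
have oB n : open (~` closure (B n)).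
  by apply: closed_openC; exact: closed_closure.
have [t [_ Bt]] := bT _ oB dB _ T0 openT.
have : (\bigcup_(A in F) A) t by rewrite FT.
by move=> [A FA At]; apply: (Bt (f A) I); apply: subset_closure; exists A.
Qed.

Lemma lindelof_nbhs_cover (V : T -> set T) : hereditary_lindelof_space T ->
  (forall t, nbhs t (V t)) ->
  exists2 D : set T, countable D & \bigcup_(t in D) V t = setT.
Proof.
move=> hl Vt.
have vT (s : T) : exists t : [set: T], set_val t = s by exact: set_val_surj.
pose P t : set [set: T] := set_val @^-1` (V t)°.
have [||F' [cF' F'F F'T]] := hl setT openT (range P).
- by move=> _ [t _ <-]; exists (V t)°; [exact: open_interior|].
- rewrite -subTset => s _; exists (P (set_val s)); first by exists (set_val s).
  exact: Vt.
have [[t0 _]|T0] := pselect (exists t : T, True); last first.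
  by exists set0 => //; rewrite -subTset => t; case: T0; exists t.
have /choice[c cP] : forall U, exists t : T, F' U -> U = P t.
  move=> U; have [/F'F[t _ <-]|nU] := pselect (F' U); first by exists t.
  (* Arbitrary value of [c] outside the subcover [F']. *)
  by exists t0.
exists (c @` F'); first by apply: sub_countable cF'; exact: card_image_le.
rewrite -subTset => s _; have [t ts] := vT s.
have : (\bigcup_(U in F') U) t by rewrite F'T.
move=> [U F'U]; rewrite {1}(cP U F'U) /P /= ts => /interior_subset Vs.
by exists (c U) => //; exists U.
Qed.

End RelativeTopology.

Lemma relatively_hausdorff_set_val (T : topologicalType) (A : set T)
    (U : set A) :
  relatively_hausdorff U -> relatively_hausdorff (set_val @` U).
Proof.
move=> hU _ _ [p Up <-] [q Uq <-] pq; congr (set_val _); apply: hU => //.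
move=> V W UV /nbhs_set_typeP[W' [oW' W'q sW]].
have [V' [oV' V'p sV]] := nbhs_set_typeP UV.
have [||_ [[[z Uz <-] V'z] W'z]] := pq (set_val @` U `&` V') W'.
- by apply: filterS (open_nbhs_nbhs (conj oV' V'p)) => y.
- exact: open_nbhs_nbhs.
by exists z; split; [exact: sV|exact: sW].
Qed.

Lemma relatively_hausdorff_preimage (S T : topologicalType) (f : S -> T)
    (A : set T) : continuous f -> injective f ->
  relatively_hausdorff A -> relatively_hausdorff (f @^-1` A).
Proof.
move=> cf fi hA p q Ap Aq pq; apply: fi; apply: hA => // V W AV Wq.
have [||z [Vz Wz]] := pq (f @^-1` V) (f @^-1` W); last by exists (f z).
- exact: cf AV.
- exact: cf.
Qed.

(** * The action, the openness of the orbit map and its consequences *)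

Section GroupAction.
Variables (G : topologicalGroupType) (X : gspaceType G).
Local Open Scope group_scope.
Local Open Scope quotient_scope.

Lemma mulg_continuousr (g : G) : continuous (fun h : G => g * h).
Proof.
move=> h; apply: (continuous_comp (f := fun h => (g, h))
  (g := fun p : G * G => p.1 * p.2)); last exact: topgroup_mul_continuous.
by apply: cvg_pair; [exact: cvg_cst|exact: cvg_id].
Qed.

Lemma mulg_continuousl (g : G) : continuous (fun h : G => h * g).
Proof.
move=> h; apply: (continuous_comp (f := fun h => (h, g))
  (g := fun p : G * G => p.1 * p.2)); last exact: topgroup_mul_continuous.
by apply: cvg_pair; [exact: cvg_id|exact: cvg_cst].
Qed.

Lemma gact_continuousr (g : G) : continuous (gact g : X -> X).
Proof.
move=> y; apply: (continuous_comp (f := fun y => (g, y))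
  (g := fun p : G * X => gact p.1 p.2)); last exact: gact_continuous.
by apply: cvg_pair; [exact: cvg_cst|exact: cvg_id].
Qed.

Lemma gact_continuousl (y : X) : continuous (fun g : G => gact g y).
Proof.
move=> g; apply: (continuous_comp (f := fun g => (g, y))
  (g := fun p : G * X => gact p.1 p.2)); last exact: gact_continuous.
by apply: cvg_pair; [exact: cvg_id|exact: cvg_cst].
Qed.

Lemma gactK (g : G) : cancel (gact g : X -> X) (gact g^-1).
Proof. by move=> y; rewrite gactM mulVg gact1. Qed.

Lemma gactKV (g : G) : cancel (gact g^-1 : X -> X) (gact g).
Proof. by move=> y; rewrite gactM mulgV gact1. Qed.

Lemma nbhs_mulg (g : G) (V : set G) :
  nbhs g V -> nbhs 1 [set h | V (g * h)].
Proof. by move=> gV; apply: (mulg_continuousr (g := g)); rewrite /= mulg1. Qed.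

Variable x : X.

Lemma gorbit_gact (g : G) (y : X) : gorbit x y -> gorbit x (gact g y).
Proof. by move=> [h _ <-]; exists (g * h) => //; rewrite gactM. Qed.

Lemma gorbit_refl : gorbit x x.
Proof. by exists 1 => //; exact: gact1. Qed.

Lemma closure_gorbit_gact (g : G) (y : X) :
  closure (gorbit x) y -> closure (gorbit x) (gact g y).
Proof.
move=> yx V /(gact_continuousr (g := g))/yx[z [xz Vz]].
by exists (gact g z); split => //; exact: gorbit_gact.
Qed.

(** Openness of g |-> g x onto the orbit, tested only at the identity; [open_orbit_map_nbhs]
    transports it to every other point by translation. *)
Definition open_orbit_map := forall N : set G, nbhs 1 N ->
  exists O, [/\ open O, O x & O `&` gorbit x `<=` (gact^~ x) @` N].

Lemma open_orbit_map_nbhs (z : gorbit x) (g : G) (N : set G) :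
  open_orbit_map -> set_val z = gact g x -> nbhs 1 N ->
  nbhs z [set y | exists2 h, N h & set_val y = gact (g * h) x].
Proof.
move=> ox zg /ox[O [oO Ox ON]].
have oO' : open (gact g^-1 @^-1` O).
  by move/continuousP: (gact_continuousr (g := g^-1)); exact.
have : nbhs z (set_val @^-1` (gact g^-1 @^-1` O)).
  apply: set_val_continuous; apply: open_nbhs_nbhs; split => //.
  by rewrite /= zg gactK.
apply: filterS => y /= Oy.
have [|h Nh hy] := ON (gact g^-1 (set_val y)).
  by split => //; apply: gorbit_gact; exact: set_valP.
by exists h => //; rewrite -gactM hy gactKV.
Qed.

Lemma pi_same_coset (g h : G) :
  \pi_(coset_space x) g = \pi_(coset_space x) h <-> stabilizer x (g^-1 * h).
Proof.
rewrite -[X in _ <-> X]asboolE.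
split=> [/(@eqmodP _ (same_coset_equiv x))|gh] //.
exact/(@eqmodP _ (same_coset_equiv x)).
Qed.

Lemma homogeneous_orbitP : homogeneous_orbit x <-> open_orbit_map.
Proof.
split => [[q [fK qK cf cq]] N N1|ox].
  pose C := [set \pi_(coset_space x) n | n in N°].
  have oC : open C.
    (* [C] is open in the quotient when its preimage in G is; that preimage is a union of right
       translates of the interior of [N] by the stabilizer. *)
    suff -> : open C = open (\bigcup_(s in stabilizer x) [set g | N° (g * s)]).
      apply: bigcup_open => s _.
      by move/continuousP: (mulg_continuousl (g := s)); apply;
        exact: open_interior.
    rewrite {1}/open /= /quotient_open; congr (open _).
    apply/seteqP; split=> [g [n Nn /esym/pi_same_coset sgn]|g [s xs Ngs]].
      by exists (g^-1 * n) => //=; rewrite mulVKg.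
    by exists (g * s) => //; apply/esym/pi_same_coset; rewrite mulKg.
  move/continuousP: cq => /(_ C oC)[O oO OE].
  exists O; split => //.
    have [z zx] := set_val_surj gorbit_refl.
    rewrite -zx; have : (q @^-1` C) z; last by rewrite -OE.
    exists 1; first exact: nbhs_singleton (nbhs_interior N1).
    rewrite -(fK (\pi 1)); congr q; apply: set_val_inj.
    by rewrite coset_to_gorbit_pi gact1.
  move=> y [+ xy]; have [z <-] := set_val_surj xy => Oz.
  have [n /interior_subset Nn qz] : (q @^-1` C) z by rewrite -OE.
  by exists n => //; rewrite -coset_to_gorbit_pi qz qK.
have /choice[r rP] : forall z : gorbit x, exists g, gact g x = set_val z.
  by move=> z; have [g _ gz] := set_valP z; exists g.
exists (fun z => \pi_(coset_space x) (r z)); split.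
- move=> c; rewrite -[RHS]reprK; apply/pi_same_coset.
  rewrite /stabilizer/= -gactM.
  suff -> : gact (repr c) x = set_val (coset_to_gorbit c) by rewrite -rP gactK.
  by rewrite set_valE.
- by move=> z; apply: set_val_inj; rewrite coset_to_gorbit_pi rP.
- apply/quotient_continuous/continuous_comp_initial.
  rewrite (_ : _ \o _ = gact^~ x); first exact: gact_continuousl.
  by apply/funext => g; exact: coset_to_gorbit_pi.
- move=> z V; rewrite nbhsE => -[C [oC Cz] CV].
  have rC : nbhs 1 [set n | C (\pi_(coset_space x) (r z * n))].
    apply: (nbhs_mulg (V := \pi_(coset_space x) @^-1` C)).
    exact: open_nbhs_nbhs.
  have := open_orbit_map_nbhs ox (esym (rP z)) rC; apply: filterS.
  move=> y [n Cn yn]; apply: CV => /=.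
  (* The chosen [r y] need not be close to [r z]; only its coset matters, and [r z * n] represents
     the same one. *)
  suff -> : \pi_(coset_space x) (r y) = \pi_(coset_space x) (r z * n) by [].
  by apply/pi_same_coset; rewrite /stabilizer/= -gactM -yn -rP gactK.
Qed.

(** T0 separates g x from x on one side only. For h in the stabilizer near g, h x = x is near g x,
    while g h^-1 x = g x is near x; so either side gives a contradiction. *)
Lemma closed_stabilizer : kolmogorov_space X -> closed (stabilizer x).
Proof.
move=> T0 g gx; apply: contrapT => /eqP/T0[A].
rewrite !inE => -[[gA Ax]|[xA Agx]].
  have [h [hx Ah]] := gx _ (gact_continuousl gA).
  by apply: Ax; rewrite -hx.
have cV : continuous (fun h : G => gact (g * h^-1) x).
  move=> h; apply: (continuous_comp (f := fun h : G => h^-1)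
    (g := fun k => gact (g * k) x)); first exact: topgroup_inv_continuous.
  apply: (continuous_comp (f := fun h : G => g * h) (g := gact^~ x)).
    exact: mulg_continuousr.
  exact: gact_continuousl.
have [|h [hx Ah]] := gx ((fun h : G => gact (g * h^-1) x) @^-1` A).
  by apply: cV; rewrite mulgV gact1.
by apply: Agx; rewrite /= -gactM (stabilizerV hx) in Ah.
Qed.

Lemma homogeneous_orbit_locally_compact : kolmogorov_space X ->
  locally_quasicompact G -> open_orbit_map -> locally_compact_space (gorbit x).
Proof.
move=> T0 lG ox.
have zP (z : gorbit x) : exists g, set_val z = gact g x.
  by have [g _ <-] := set_valP z; exists g.
split=> [z U|p q pq].
  move=> /nbhs_set_typeP[W [oW Wz WU]]; have [g zg] := zP z.
  have [|K [K1 cK KW]] := lG 1 [set k | W (gact (g * k) x)].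
    apply: (nbhs_mulg (V := [set k | W (gact k x)])).
    apply: (gact_continuousl (y := x)); apply: open_nbhs_nbhs.
    by rewrite -zg.
  exists [set y | exists2 h, K h & set_val y = gact (g * h) x].
  split.
  - exact: open_orbit_map_nbhs.
  - have /choice[f fP] k : exists y : gorbit x, set_val y = gact (g * k) x.
      by apply: set_val_surj; exists (g * k).
    have cf : continuous f.
      apply: continuous_comp_initial.
      rewrite (_ : _ \o _ = fun k => gact (g * k) x); last exact/funext.
      move=> k; apply: (continuous_comp (f := fun h => g * h) (g := gact^~ x)).
        exact: mulg_continuousr.
      exact: gact_continuousl.
    apply/compact_coverP; rewrite (_ : [set y | _] = f @` K).
      apply: continuous_compact; first exact: continuous_subspaceT.
      exact/compact_coverP.
    apply/seteqP; split=> [y [k Kk yk]|_ [k Kk <-]]; last by exists k.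
    by exists k => //; apply: set_val_inj; rewrite fP.
  - by move=> y [k Kk yk]; apply: WU; rewrite /= yk; exact: KW.
have [a pa] := zP p; have [b qb] := zP q.
apply: contrapT => npq.
have nab : ~ stabilizer x (a^-1 * b).
  move=> ab; apply: npq; apply: set_val_inj.
  by rewrite pa qb -[in LHS]ab gactM mulVKg.
(* At (1, 1) this lies outside the closed stabilizer, hence also nearby: the neighborhoods of [p]
   and [q] given by openness are then disjoint. *)
pose d (u : G * G) := (a * u.1)^-1 * (b * u.2).
have cd : continuous d.
  move=> u; apply: (continuous_comp
    (f := fun u : G * G => ((a * u.1)^-1, b * u.2))
    (g := fun v : G * G => v.1 * v.2)); last exact: topgroup_mul_continuous.
  apply: cvg_pair => /=.
    apply: (continuous_comp (f := fun u : G * G => a * u.1)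
      (g := fun h : G => h^-1)).
      apply: (continuous_comp (f := fst) (g := fun h : G => a * h)).
        exact: cvg_fst.
      exact: mulg_continuousr.
    exact: topgroup_inv_continuous.
  apply: (continuous_comp (f := snd) (g := fun h : G => b * h)).
    exact: cvg_snd.
  exact: mulg_continuousr.
have [|[N M] [/= N1 M1] NM] := cd (1, 1) (~` stabilizer x).
  apply: open_nbhs_nbhs; split; last by rewrite /d /= !mulg1.
  exact: closed_openC (closed_stabilizer T0).
have [y [[n Nn yn] [m Mm ym]]] := pq _ _ (open_orbit_map_nbhs ox pa N1)
  (open_orbit_map_nbhs ox qb M1).
apply: (NM (n, m)) => //.
by rewrite /stabilizer /d/= -gactM -ym yn gactK.
Qed.

(** A non-empty open part of the closure contains some g x; pulling it back by g, which preserves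
    the closure, brings it to x. *)
Lemma hausdorff_nbhs_gorbit :
  (exists U : set (closure (gorbit x)),
      [/\ U !=set0, open U & hausdorff_space U]) ->
  exists W, [/\ open W, W x & relatively_hausdorff (W `&` closure (gorbit x))].
Proof.
move=> [U [+ oU]]; case: oU => W oW <- [u Wu] hU.
have [_ [[g _ <-] Wg]] := set_valP u W (open_nbhs_nbhs (conj oW Wu)).
exists (gact g @^-1` W); split => //.
  by move/continuousP: (gact_continuousr (g := g)); exact.
have := relatively_hausdorff_preimage (gact_continuousr (g := g))
  (can_inj (gactK g)) (relatively_hausdorff_set_val (hausdorff_set_type hU)).
congr relatively_hausdorff; apply/seteqP; split=> y.
  move=> [z Wz zy]; split; first by rewrite /= -zy.
  rewrite -(gactK g y) -zy; apply: closure_gorbit_gact; exact: set_valP.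
move=> [/= Wy /(closure_gorbit_gact (g := g))/set_val_surj[z zy]].
by exists z => //; rewrite /= zy.
Qed.

(** * Compactness inside a Hausdorff neighborhood of x in the orbit closure *)

Section HausdorffNeighborhood.
Variable W : set X.
Hypotheses (oW : open W) (Wx : W x).
Hypothesis hW : relatively_hausdorff (W `&` closure (gorbit x)).

Lemma locally_compact_gorbit_closed :
  locally_quasicompact (gorbit x) -> locally_closed (gorbit x).
Proof.
move=> lx.
have [z zx] := set_val_surj gorbit_refl.
have [|K [zK cK KW]] := lx z (set_val @^-1` W).
  by apply: set_val_continuous; apply: open_nbhs_nbhs; rewrite zx.
have [O [oO Oz OK]] := nbhs_set_typeP zK.
pose V := O `&` W.
have oV : open V by exact: openI.
have Vx : V x by split => //; rewrite -zx.
(* Such a point is a limit of orbit points in [V], all of which lie in the compact [K]; and [K] is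
   relatively closed inside [W]. *)
have VK : V `&` closure (gorbit x) `<=` gorbit x.
  move=> y [Vy xy].
  suff [k _ <-] : (set_val @` K) y by exact: set_valP.
  apply: (compact_relatively_closed hW).
  - apply: continuous_compact; last exact/compact_coverP.
    apply: continuous_subspaceT; exact: set_val_continuous.
  - move=> _ [k Kk <-]; split; first exact: KW.
    by apply: subset_closure; exact: set_valP.
  - split; first by split => //; case: Vy.
    move=> B yB; have [|t [xt [Bt [Ot Wt]]]] := xy (B `&` V).
      by apply: filterI => //; exact: open_nbhs_nbhs.
    have [s st] := set_val_surj xt; exists t; split => //; exists s => //.
    by apply: OK; rewrite /= st.
exists (closure (gorbit x)), (\bigcup_(g in [set: G]) gact g^-1 @^-1` V).
split; first exact: closed_closure.
  apply: bigcup_open => g _.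
  by move/continuousP: (gact_continuousr (g := g^-1)); exact.
apply/seteqP; split=> [y xy|y [xy [g _ Vy]]].
  split; first exact: subset_closure.
  by have [g _ <-] := xy; exists g => //=; rewrite gactK.
rewrite -(gactKV g y); apply: gorbit_gact; apply: VK; split => //.
exact: closure_gorbit_gact.
Qed.

(** Take M with M^-1 M inside N and a compact neighborhood K of 1 in M with K x inside W. Countably
    many g K cover G, so the closure in the orbit of some g K x has interior. Moved back by g^-1 and
    cut down to W, this interior lies in K x; moved by k^-1 for a suitable k in K, it becomes a
    neighborhood of x inside k^-1 K x, hence inside N x. *)
Lemma baire_gorbit_open : hereditary_lindelof_space G ->
  locally_quasicompact G -> baire_space (gorbit x) -> open_orbit_map.
Proof.
move=> hG lG bx N N1.
have [M [M1 MN]] : exists M, nbhs 1 M /\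
    forall m n, M m -> M n -> N (m^-1 * n).
  have cd : continuous (fun u : G * G => u.1^-1 * u.2).
    move=> u; apply: (continuous_comp (f := fun u : G * G => (u.1^-1, u.2))
      (g := fun v : G * G => v.1 * v.2)); last exact: topgroup_mul_continuous.
    apply: cvg_pair => /=; last exact: cvg_snd.
    apply: (continuous_comp (f := fst) (g := fun h : G => h^-1)).
      exact: cvg_fst.
    exact: topgroup_inv_continuous.
  have [|[A B] [/= A1 B1] AB] := cd (1, 1) N; first by rewrite /= invg1 mul1g.
  exists (A `&` B); split; first exact: filterI.
  by move=> m n [Am _] [_ Bn]; exact: (AB (m, n)).
have [|K [K1 cK KMW]] := lG 1 (M `&` [set k | W (gact k x)]).
  apply: filterI => //; apply: (gact_continuousl (y := x)).
  by apply: open_nbhs_nbhs; rewrite gact1.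
have [|D cD DT] :=
    lindelof_nbhs_cover (V := fun g => [set h | K (g^-1 * h)]) hG.
  move=> g; apply: (mulg_continuousr (g := g^-1)).
  by rewrite mulVg.
pose E g : set (gorbit x) :=
  [set y | exists2 k, K k & set_val y = gact (g * k) x].
have [|||_ [g Dg <-] [z zE]] := baire_countable_cover (F := E @` D) bx.
- by have [z _] := set_val_surj gorbit_refl; exists z.
- by apply: sub_countable cD; exact: card_image_le.
- rewrite -subTset => y _; have [h _ hy] := set_valP y.
  have : (\bigcup_(t in D) [set h | K (t^-1 * h)]) h by rewrite DT.
  move=> [g Dg Kh]; exists (E g); first by exists g.
  by exists (g^-1 * h) => //; rewrite mulVKg.
have [O [oO Oz OE]] := nbhs_set_typeP zE.
have KxW : [set gact k x | k in K] `<=` W `&` closure (gorbit x).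
  move=> _ [k Kk <-]; split; first by have [] := KMW k Kk.
  by apply: subset_closure; exists k.
have cKx : compact [set gact k x | k in K].
  apply: continuous_compact; last exact/compact_coverP.
  by apply: continuous_subspaceT; exact: gact_continuousl.
(* Translating back by [g] is essential: [K x] lies in [W], where it is relatively closed, whereas
   [g K x] may leave [W]. *)
have OKx : gact g @^-1` O `&` W `&` gorbit x `<=` [set gact k x | k in K].
  move=> y [[Oy Wy] xy]; apply: (compact_relatively_closed hW cKx KxW).
  split; first by split => //; exact: subset_closure.
  have [t ty] := set_val_surj (gorbit_gact g xy).
  move=> B yB.
  have [||s [[k Kk sk] Bs]] := OE t _ (set_val @^-1` (gact g^-1 @^-1` B)).
  - by rewrite /= ty.
  - apply: set_val_continuous; apply: (gact_continuousr (g := g^-1)).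
    by rewrite ty gactK.
  exists (gact k x); split; first by exists k.
  by rewrite /= sk -gactM gactK in Bs.
(* [O] is a neighborhood of a point of the closure of [E g], so it meets [E g] itself. *)
have [k Kk Ok] : exists2 k, K k & O (gact (g * k) x).
  have [s [[k Kk sk] Os]] := OE z Oz (set_val @^-1` O)
    (set_val_continuous (open_nbhs_nbhs (conj oO Oz))).
  by exists k => //; rewrite -sk.
exists (gact k @^-1` (gact g @^-1` O `&` W)); split.
- move/continuousP: (gact_continuousr (g := k)); apply; apply: openI => //.
  by move/continuousP: (gact_continuousr (g := g)); apply.
- by split; [rewrite /= gactM|have [] := KMW k Kk].
move=> y [Oy xy]; have [|m Km my] := OKx (gact k y).
  by split => //; exact: gorbit_gact.
exists (k^-1 * m); last by rewrite -gactM my gactK.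
by apply: MN; [have [] := KMW k Kk|have [] := KMW m Km].
Qed.

End HausdorffNeighborhood.

Lemma locally_closed_gorbit_Gdelta : locally_closed (gorbit x) ->
  Gdelta [set y : closure (gorbit x) | gorbit x (set_val y)].
Proof.
move=> [C [U [cC oU xE]]]; apply: open_Gdelta; exists U => //.
have xC : gorbit x `<=` C by rewrite xE; exact: subIsetl.
have xU : gorbit x `<=` U by rewrite xE; exact: subIsetr.
apply/seteqP; split=> y /=; last exact: xU.
move=> Uy; suff : (C `&` U) (set_val y) by rewrite -xE.
split => //; apply: cC; apply: closureS xC _ _; exact: set_valP.
Qed.

End GroupAction.

Theorem proposition18 (G : topologicalGroupType) (X : gspaceType G) (x : X)
    (G_T0 : kolmogorov_space G) (X_T0 : kolmogorov_space X)
    (G_lindelof : hereditary_lindelof_space G)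
    (G_lcompact : locally_compact_space G)
    (X_baire : totally_baire_space X)
    (hausdorff_open : exists U : set (closure (gorbit x)),
      [/\ U !=set0, open U & hausdorff_space U]) :
  [<-> homogeneous_orbit x;
       locally_compact_space (gorbit x);
       locally_closed (gorbit x);
       Gdelta [set y : closure (gorbit x) | gorbit x (set_val y)];
       baire_space (gorbit x)].
Proof.
have [W [oW Wx hW]] := hausdorff_nbhs_gorbit hausdorff_open.
tfae.
- move=> /homogeneous_orbitP.
  exact: homogeneous_orbit_locally_compact X_T0 G_lcompact.1.
- by move=> [+ _]; exact: locally_compact_gorbit_closed oW Wx hW.
- exact: locally_closed_gorbit_Gdelta.
- by apply: dense_Gdelta_baire; apply: X_baire; exact: closed_closure.
- move=> bx; apply/homogeneous_orbitP.
  exact: (baire_gorbit_open oW Wx hW G_lindelof G_lcompact.1 bx).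
Qed.
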